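(* Let $(\mathcal{F},\oplus,+)$ be a commutative perfect Banach semi-field of characteristic $1$ (with fixed element $E$). Then the map $$\Theta:(\mathcal{F},\oplus,+)\to (C^0(S_E(\mathcal{F}),\mathbb{R}),\max(\,,),+),\qquad X\mapsto \Theta_X,\quad \Theta_X(\phi)=\phi(X)\ \ (\phi\in S_E(\mathcal{F})),$$ is an isometric isomorphism of Banach semi-fields (a bijection onto $C^0(S_E(\mathcal{F}),\mathbb{R})$ with $\Theta_{X\oplus Y}=\max(\Theta_X,\Theta_Y)$ and $\Theta_{X+Y}=\Theta_X+\Theta_Y$), and $$\forall X\in\mathcal{F},\quad r(X)=\sup_{\phi\in S_E(\mathcal{F})}|\Theta_X(\phi)|.$$ Moreover, $\Theta_E$ is the constant function $\phi\mapsto 1$.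
   Context: A commutative perfect semi-field of characteristic $1$ is a triple $(\mathcal{F},\oplus,+)$ where: $\oplus$ is a commutative associative law with $X\oplus X=X$ for all $X$; $(\mathcal{F},+)$ is an abelian group with identity $0$ and $X+(Y\oplus Z)=(X+Y)\oplus(X+Z)$ for all $X,Y,Z$; for every integer $n\ge 1$ the map $X\mapsto nX$ is surjective (it is then bijective, and $(\mathcal F,+)$ is naturally a $\mathbb{Q}$-vector space). Partial order: $X\le Y$ iff $X\oplus Y=Y$. Standing assumptions: $\mathcal{F}\neq\{0\}$; there is a fixed $E\in\mathcal{F}$ such that for every $X\in\mathcal{F}$ there is $t\in\mathbb{Q}^+$ (non-negative rationals) with $-tE\le X\le tE$; $r(X)\in\mathbb{R}^+$ denotes the infimum of all such $t$; and $r(X)=0$ if and only if $X=0$. Then $(X,Y)\mapsto r(X-Y)$ is a distance; $\mathcal{F}$ is called Banach if it is complete for this distance. A character of $\mathcal{F}$ is a map $\phi:\mathcal{F}\to\mathbb{R}$, not identically zero, with $\phi(X\oplus Y)=\max(\phi(X),\phi(Y))$ and $\phi(X+Y)=\phi(X)+\phi(Y)$ for all $X,Y$. $S_E(\mathcal{F})$ is the set of characters with $\phi(E)=1$, endowed with the weakest topology $\mathcal{T}$ making all maps $\phi\mapsto\phi(X)$, $X\in\mathcal{F}$, continuous. *)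

(* Defs.v *)
From HB Require Import structures.
From mathcomp Require Import all_boot all_order all_algebra.
From mathcomp Require Import all_classical all_reals all_analysis.
Set Implicit Arguments.
Unset Strict Implicit.
Unset Printing Implicit Defensive.
Import Order.TTheory GRing.Theory Num.Theory.
Import numFieldNormedType.Exports.
Local Open Scope classical_set_scope.
Local Open Scope ring_scope.

(* Commutative perfect semi-fields of characteristic 1. The "multiplication"
   of the semi-field is the group law + of the underlying zmodType and its
   "addition" is oplus, which is not required to have a neutral element. *)
HB.mixin Record Zmodule_isPerfectSemifield F & GRing.Zmodule F := {
  oplus : F -> F -> F;
  oplusA : associative oplus;
  oplusC : commutative oplus;
  oplusxx : idempotent_op oplus;
  addr_oplusr : right_distributive (@GRing.add F) oplus;
  mulrn_surj : forall n, (0 < n)%N -> forall Y : F, exists X : F, X *+ n = Y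
}.

#[short(type = "perfectSemifieldType")]
HB.structure Definition PerfectSemifield :=
  {F of Zmodule_isPerfectSemifield F & GRing.Zmodule F}.

Definition sfle (F : perfectSemifieldType) (X Y : F) : Prop := oplus X Y = Y.

(* The rational multiple (p/q)X is p times the (unique) Y with qY = X; the
   default value 0 of xget is never reached, by mulrn_surj. *)
Definition ratscale (F : perfectSemifieldType) (t : rat) (X : F) : F :=
  xget 0 [set Y : F | Y *+ `|denq t|%N = X] *~ numq t.

Definition unit_bound (F : perfectSemifieldType) (E X : F) : set rat :=
  [set t | [/\ 0 <= t, sfle (- ratscale t E) X & sfle X (ratscale t E)]].

Definition unit_radius (R : realType) (F : perfectSemifieldType) (E X : F) : R :=
  inf [set ratr t | t in unit_bound E X].

Arguments unit_radius R {F} E X.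

Record standing_assumptions (R : realType) (F : perfectSemifieldType) (E : F) :
    Prop := StandingAssumptions {
  semifield_nontrivial : exists X : F, X != 0;
  unit_bound_nonempty : forall X : F, unit_bound E X !=set0;
  unit_radius_eq0 : forall X : F, unit_radius R E X = 0 <-> X = 0
}.

Definition radius_complete (R : realType) (F : perfectSemifieldType) (E : F) :
    Prop :=
  forall u : nat -> F,
    (forall e : R, 0 < e -> exists N, forall m n,
       (N <= m)%N -> (N <= n)%N -> unit_radius R E (u m - u n) < e) ->
    exists l : F, unit_radius R E (u n - l) @[n --> \oo] --> (0 : R).

Definition banach_semifield (R : realType) (F : perfectSemifieldType) (E : F) :
    Prop :=
  standing_assumptions R E /\ radius_complete R E.

Definition is_character (R : realType) (F : perfectSemifieldType)
    (phi : F -> R) : Prop :=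
  [/\ exists X, phi X != 0,
      {morph phi : X Y / oplus X Y >-> Num.max X Y} &
      {morph phi : X Y / X + Y >-> X + Y}].

Definition charspace (R : realType) (F : perfectSemifieldType) (E : F) : Type :=
  set_type [set phi : F -> R | is_character phi /\ phi E = 1].

Arguments charspace R {F} E.

Definition chareval (R : realType) (F : perfectSemifieldType) (E : F)
    (X : F) (phi : charspace R E) : R := val phi X.

(* The weakest topology making all the evaluations continuous: the supremum,
   over X : F, of the initial topologies of the maps phi |-> phi X. *)
HB.instance Definition _ (R : realType) (F : perfectSemifieldType) (E : F) :=
  Choice.on (charspace R E).
HB.instance Definition _ (R : realType) (F : perfectSemifieldType) (E : F) :=
  Topological.copy (charspace R E)
    (sup_topology (fun X : F => Topological.class
       (initial_topology (@chareval R F E X)))).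

Lemma chareval_continuous (R : realType) (F : perfectSemifieldType) (E X : F) :
  continuous (@chareval R F E X).
Proof.
move=> phi A /initial_continuous.
by have /cvg_sup/(_ X) : phi --> phi by []; apply.
Qed.

(* C^0(T, R), that is continuousType T R, with pointwise max and +. *)
Section ContinuousSemifield.
Variables (T : topologicalType) (R : realType).
Implicit Types f g h : continuousType T R.

Definition cts0 : continuousType T R := cst 0.
Lemma ctsN_cont f : continuous (fun x => - f x).
Proof. by move=> x; apply: cvgN; exact: cts_fun. Qed.
Lemma ctsD_cont f g : continuous (fun x => f x + g x).
Proof. by move=> x; apply: cvgD; exact: cts_fun. Qed.
Lemma ctsmax_cont f g : continuous (fun x => Num.max (f x) (g x)).
Proof. by move=> x; apply: continuous_max; exact: cts_fun. Qed.

Definition ctsN f : continuousType T R := mkcts (@ctsN_cont f).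
Definition ctsD f g : continuousType T R := mkcts (@ctsD_cont f g).
Definition ctsmax f g : continuousType T R := mkcts (@ctsmax_cont f g).

Lemma ctsDA : associative ctsD.
Proof. by move=> f g h; apply/continuousEP => x; exact: addrA. Qed.
Lemma ctsDC : commutative ctsD.
Proof. by move=> f g; apply/continuousEP => x; exact: addrC. Qed.
Lemma cts0D : left_id cts0 ctsD.
Proof. by move=> f; apply/continuousEP => x; exact: add0r. Qed.
Lemma ctsND : left_inverse cts0 ctsN ctsD.
Proof. by move=> f; apply/continuousEP => x; exact: addNr. Qed.

HB.instance Definition _ :=
  GRing.isZmodule.Build (continuousType T R) ctsDA ctsDC cts0D ctsND.

Lemma ctsmaxA : associative ctsmax.
Proof. by move=> f g h; apply/continuousEP => x; exact: maxA. Qed.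
Lemma ctsmaxC : commutative ctsmax.
Proof. by move=> f g; apply/continuousEP => x; exact: maxC. Qed.
Lemma ctsmaxxx : idempotent_op ctsmax.
Proof. by move=> f; apply/continuousEP => x; exact: maxxx. Qed.
Lemma ctsD_max : right_distributive +%R ctsmax.
Proof. by move=> f g h; apply/continuousEP => x; exact: addr_maxr. Qed.
Lemma cts_mulrnE f n x : (f *+ n) x = f x *+ n.
Proof. by elim: n => [|n IH] //; rewrite !mulrS -IH. Qed.
Lemma cts_mulrn_surj n : (0 < n)%N ->
  forall f, exists g : continuousType T R, g *+ n = f.
Proof.
move=> n0 f.
have gc : continuous (fun x => f x * n%:R^-1).
  by move=> x; apply: cvgM; [exact: cts_fun | exact: cvg_cst].
exists (mkcts gc : continuousType T R); apply/continuousEP => x.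
rewrite cts_mulrnE -[LHS]/((f x / n%:R) *+ n).
by rewrite -mulr_natr mulfVK// pnatr_eq0 -lt0n.
Qed.

HB.instance Definition _ :=
  Zmodule_isPerfectSemifield.Build (continuousType T R)
    ctsmaxA ctsmaxC ctsmaxxx ctsD_max cts_mulrn_surj.

End ContinuousSemifield.

Definition Theta (R : realType) (F : perfectSemifieldType) (E X : F) :
    continuousType (charspace R E) R :=
  mkcts (@chareval_continuous R F E X).
Arguments Theta R {F} E X.

(* Main.v *)
(* Every semi-field of characteristic 1 is a lattice-ordered group, hence torsion
   free. The gauge p X = inf {t | X <= tE} is sublinear and sends oplus to max;
   both properties survive replacing a functional q by its drop along X, namely
   Y |-> inf_n (q (Y + nX) - n q X), and taking infima of chains. A minimal such
   functional equals all its drops, hence is additive, i.e. it is a character.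
   Starting Zorn's lemma from the drop of p along X gives a character phi with
   phi X = p X, so r X = max (p X, p (-X)) is the sup norm of Theta_X. The
   character space is compact, the lattice form of the Stone-Weierstrass argument
   makes the image of Theta dense, and completeness makes it everything. *)
Require Import Defs.
From HB Require Import structures.
From mathcomp Require Import all_boot all_order all_algebra.
From mathcomp Require Import all_classical all_reals all_analysis.
From mathcomp Require Import lra.
Import Order.TTheory GRing.Theory Num.Theory.
Import numFieldNormedType.Exports.
Local Open Scope classical_set_scope.
Local Open Scope ring_scope.

Set Implicit Arguments.
Unset Strict Implicit.
Unset Printing Implicit Defensive.

(** * Order, torsion-freeness and rational multiples *)

Section SemifieldOrder.
Context {F : perfectSemifieldType}.
Implicit Types (X Y Z : F) (n : nat).

Lemma sfle_refl X : sfle X X. Proof. exact: oplusxx. Qed.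

Lemma sfle_trans Y X Z : sfle X Y -> sfle Y Z -> sfle X Z.
Proof. by rewrite /sfle => XY <-; rewrite oplusA XY. Qed.

Lemma sfle_anti X Y : sfle X Y -> sfle Y X -> X = Y.
Proof. by rewrite /sfle oplusC => -> ->. Qed.

Lemma sfle_oplusl X Y : sfle X (oplus X Y).
Proof. by rewrite /sfle oplusA oplusxx. Qed.

Lemma sfle_oplusr X Y : sfle Y (oplus X Y).
Proof. by rewrite oplusC; exact: sfle_oplusl. Qed.

Lemma oplus_sfle X Y Z : sfle X Z -> sfle Y Z -> sfle (oplus X Y) Z.
Proof. by rewrite /sfle -oplusA => XZ ->. Qed.

Lemma addr_oplusl X Y Z : oplus X Y + Z = oplus (X + Z) (Y + Z).
Proof. by rewrite -!(addrC Z) addr_oplusr. Qed.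

Lemma sfleD2l Z X Y : sfle X Y -> sfle (Z + X) (Z + Y).
Proof. by rewrite /sfle -addr_oplusr => ->. Qed.

Lemma sfleD X Y X' Y' : sfle X Y -> sfle X' Y' -> sfle (X + X') (Y + Y').
Proof.
move=> XY XY'; apply: (@sfle_trans (X + Y')); first exact: sfleD2l.
by rewrite -!(addrC Y'); exact: sfleD2l.
Qed.

Lemma sfle_subr_ge0 X Y : sfle X Y <-> sfle 0 (Y - X).
Proof.
split=> [/(sfleD2l (- X))|/(sfleD2l X)]; first by rewrite addNr addrC.
by rewrite addr0 addrC subrK.
Qed.

Lemma sfleN X Y : sfle X Y -> sfle (- Y) (- X).
Proof. by move=> /sfle_subr_ge0 XY; apply/sfle_subr_ge0; rewrite opprK addrC. Qed.

Lemma sfle_mulrn n X Y : sfle X Y -> sfle (X *+ n) (Y *+ n).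
Proof.
move=> XY; elim: n => [|n IH]; first exact: sfle_refl.
by rewrite !mulrS; exact: sfleD.
Qed.

Lemma mulrn_ge0 n X : sfle 0 X -> sfle 0 (X *+ n).
Proof. by move/(sfle_mulrn n); rewrite mul0rn. Qed.

(** Expanding the left side gives the join of all [X *+ k] with k at most n+1, and the terms with k
    at most n already make up [oplus X 0 *+ n]. *)
Lemma oplus0_mulrS n X :
  oplus X 0 *+ n.+1 = oplus (X *+ n.+1) (oplus X 0 *+ n).
Proof.
elim: n => [|n IH]; first by rewrite mulr1n mulr0n mulr1n.
rewrite mulrS {1}IH addr_oplusr -mulrS addr_oplusl add0r -mulrS -oplusA.
by congr oplus; apply: sfle_mulrn; exact: sfle_oplusl.
Qed.

(** With W = [oplus X 0], the hypothesis lets the previous expansion absorb its first term. This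
    leaves (n+1)W = nW, and cancelling gives W = 0. *)
Lemma mulrn_le0 n X : (0 < n)%N -> sfle (X *+ n) 0 -> sfle X 0.
Proof.
case: n => // n _ nX.
have W0 : sfle 0 (oplus X 0) := sfle_oplusr X 0.
have := oplus0_mulrS n X.
have -> : oplus (X *+ n.+1) (oplus X 0 *+ n) = oplus X 0 *+ n.
  by rewrite -/(sfle _ _); exact: sfle_trans nX (mulrn_ge0 n W0).
by rewrite mulrSr -[RHS]add0r addrC => /addIr.
Qed.

Lemma sfle_pmulrn n X Y : (0 < n)%N -> sfle (X *+ n) (Y *+ n) -> sfle X Y.
Proof.
move=> n0 XY; have : sfle (X - Y) 0.
  apply: (mulrn_le0 n0); rewrite mulrnBl.
  by have := sfleD2l (- (Y *+ n)) XY; rewrite addNr addrC.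
by move/(sfleD2l Y); rewrite addr0 addrC subrK.
Qed.

Lemma mulrn_pinj n X Y : (0 < n)%N -> X *+ n = Y *+ n -> X = Y.
Proof.
move=> n0 XY; have [le ge] : sfle (X *+ n) (Y *+ n) /\ sfle (Y *+ n) (X *+ n).
  by rewrite XY; split; exact: sfle_refl.
by apply: sfle_anti; exact: sfle_pmulrn n0 _.
Qed.

Lemma ratscaleP (t : rat) X : ratscale t X *+ `|denq t|%N = X *~ numq t.
Proof.
rewrite /ratscale.
have d0 : (0 < `|denq t|)%N by rewrite absz_gt0 denq_eq0.
have [Y YX] := mulrn_surj _ d0 X.
case: xgetP => [Z _ <-|/(_ Y)//].
by rewrite !pmulrn mulrzAC.
Qed.

Lemma mulr_absz_denq (t : rat) : t * `|denq t|%:R = (numq t)%:~R.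
Proof. by rewrite pmulrn absz_denq -numqE. Qed.

(** [ratscale] is defined through the reduced fraction; allowing any m/d makes sums computable over
    a common denominator. Both sides are compared after multiplication by [denq t], which is
    injective. *)
Lemma ratscaleE (t : rat) (m : int) (d : nat) X :
  t * d%:R = m%:~R -> ratscale t X *+ d = X *~ m.
Proof.
move=> tdm; have q0 : (0 < `|denq t|)%N by rewrite absz_gt0 denq_eq0.
apply: (mulrn_pinj q0).
rewrite mulrnAC ratscaleP !pmulrn -!mulrzA; congr (_ *~ _).
have dq : `|denq t|%:Z = denq t by rewrite absz_denq.
apply/eqP; rewrite dq -(eqr_int rat) !rmorphM /= -tdm mulrAC -[X in X * _ * _]divq_num_den.
by rewrite divfK ?intr_eq0 ?denq_neq0.
Qed.

Lemma ratscale_unique (t : rat) (m : int) (d : nat) X Y : (0 < d)%N ->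
  t * d%:R = m%:~R -> Y *+ d = X *~ m -> Y = ratscale t X.
Proof.
by move=> d0 /(ratscaleE X) tX YX; apply: (mulrn_pinj d0); rewrite YX tX.
Qed.

Lemma ratscale1 X : ratscale 1 X = X.
Proof. by symmetry; apply: (@ratscale_unique _ 1 1). Qed.

Lemma ratscaleD (s t : rat) X :
  ratscale (s + t) X = ratscale s X + ratscale t X.
Proof.
set a := `|denq s|%N; set b := `|denq t|%N.
have a0 : (0 < a)%N by rewrite absz_gt0 denq_eq0.
have b0 : (0 < b)%N by rewrite absz_gt0 denq_eq0.
have sa : s * a%:R = (numq s)%:~R := mulr_absz_denq s.
have tb : t * b%:R = (numq t)%:~R := mulr_absz_denq t.
symmetry; apply: (@ratscale_unique _ (numq s * b + numq t * a) (a * b)).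
- by rewrite muln_gt0 a0.
- rewrite intrD !intrM -sa -tb natrM mulrDl mulrA; congr (_ + _).
  by rewrite mulrCA mulrC.
- rewrite mulrnDl mulrnA (ratscaleE _ sa) mulnC mulrnA (ratscaleE _ tb).
  by rewrite mulrzDr !mulrzA.
Qed.

Lemma ratscale0 X : ratscale 0 X = 0.
Proof. by apply: (addrI (ratscale 0 X)); rewrite -ratscaleD !addr0. Qed.

Lemma ratscaleN (t : rat) X : ratscale (- t) X = - ratscale t X.
Proof. by apply/eqP; rewrite -addr_eq0 -ratscaleD addNr ratscale0. Qed.

Lemma ratscalerN (t : rat) X : ratscale t (- X) = - ratscale t X.
Proof.
have d0 : (0 < `|denq t|)%N by rewrite absz_gt0 denq_eq0.
by apply: (mulrn_pinj d0); rewrite mulNrn !ratscaleP mulNrz.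
Qed.

Lemma ratscaler0 (t : rat) : ratscale t (0 : F) = 0.
Proof.
have d0 : (0 < `|denq t|)%N by rewrite absz_gt0 denq_eq0.
by apply: (mulrn_pinj d0); rewrite ratscaleP mul0rz mul0rn.
Qed.

Lemma ratscaleMn (t : rat) n X : ratscale (t *+ n) X = ratscale t X *+ n.
Proof.
by elim: n => [|n IH]; rewrite ?ratscale0// !mulrS ratscaleD IH.
Qed.

Lemma ratscale_pge0 (t : rat) X : 0 < t -> sfle 0 (ratscale t X) <-> sfle 0 X.
Proof.
move=> t0; have q0 : (0 < `|denq t|)%N by rewrite absz_gt0 denq_eq0.
have n0 : (0 < `|numq t|)%N by rewrite absz_gt0 numq_eq0 gt_eqF.
have nE : numq t = `|numq t|%N by rewrite gez0_abs// ltW// numq_gt0.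
split=> [/(mulrn_ge0 `|denq t|)|/(mulrn_ge0 `|numq t|)] X0.
  by apply: (sfle_pmulrn n0); move: X0; rewrite mul0rn ratscaleP nE.
by apply: (sfle_pmulrn q0); rewrite mul0rn ratscaleP nE.
Qed.

End SemifieldOrder.

(** * Sublinear functionals, their drops and minimal elements *)

Section MaxSublinear.
Context {R : realType} {F : perfectSemifieldType}.
Implicit Types (X Y Z : F) (n : nat) (p q : F -> R).

(** Subadditivity gives the reverse of [max_sublinearMn] for positive n, so q is homogeneous under
    positive integers. *)
Record max_sublinear q : Prop := MaxSublinear {
  max_sublinearD : forall X Y, q (X + Y) <= q X + q Y;
  max_sublinear_oplus : {morph q : X Y / oplus X Y >-> Num.max X Y};
  max_sublinearMn : forall n X, q X *+ n <= q (X *+ n) }.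

Lemma max_sublinear_0 q : max_sublinear q -> q 0 = 0.
Proof.
move=> mq; apply/eqP; rewrite eq_le (max_sublinearMn mq 0 0) andbT.
by have := max_sublinearMn mq 2 0; rewrite mul0rn mulr2n gerDl.
Qed.

Lemma max_sublinear_opp q X : max_sublinear q -> - q (- X) <= q X.
Proof.
move=> mq; rewrite -subr_ge0 opprK -(max_sublinear_0 mq) -(subrr X).
exact: max_sublinearD.
Qed.

(** Serves both drops and chains. Single terms of a drop are not known to be subadditive, hence the
    mixed inequality with a third member d. Downward directedness yields the maximum property, and b
    keeps the infima finite. *)
Lemma max_sublinear_inf (A : set (F -> R)) (b : F -> R) :
    A !=set0 ->
    (forall a X, A a -> b X <= a X) ->
    (forall a X Y, A a -> a (oplus X Y) = Num.max (a X) (a Y)) ->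
    (forall a n X, A a -> a X *+ n <= a (X *+ n)) ->
    (forall a c, A a -> A c ->
       exists2 d, A d & forall X, d X <= a X /\ d X <= c X) ->
    (forall a c X Y, A a -> A c -> exists2 d, A d & d (X + Y) <= a X + c Y) ->
  max_sublinear (fun X => inf [set a X | a in A]).
Proof.
move=> [a0 Aa0] Ab Amax Amuln Adir Asub.
have infle a X : A a -> inf [set a X | a in A] <= a X.
  by move=> Aa; apply: ge_inf; [exists (b X) => _ [c Ac <-]; exact: Ab|exists a].
have leinf r X : (forall a, A a -> r <= a X) -> r <= inf [set a X | a in A].
  by move=> rA; apply: lb_le_inf; [exists (a0 X), a0|move=> _ [a Aa <-]; exact: rA].
have inflt r X : inf [set a X | a in A] < r -> exists2 a, A a & a X < r.
  by move=> /inf_lt[|_ [a Aa <-]]; [exists (a0 X), a0|exists a].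
split=> [X Y|X Y|n X].
- apply/ler_addgt0Pr => e e0.
  have [a Aa aX] : exists2 a, A a & a X < inf [set a X | a in A] + e / 2.
    by apply: inflt; rewrite ltrDl divr_gt0.
  have [c Ac cY] : exists2 a, A a & a Y < inf [set a Y | a in A] + e / 2.
    by apply: inflt; rewrite ltrDl divr_gt0.
  have [d Ad dXY] := Asub a c X Y Aa Ac.
  apply: (le_trans (infle _ _ Ad)); apply: (le_trans dXY).
  by rewrite [e]splitr addrACA lerD// ltW.
- apply/eqP; rewrite eq_le; apply/andP; split; last first.
    rewrite ge_max; apply/andP; split; apply: leinf => a Aa;
      apply: (le_trans (infle _ _ Aa)); by rewrite (Amax _ _ _ Aa) le_max lexx ?orbT.
  rewrite leNgt; apply/negP; rewrite gt_max => /andP[/inflt[a Aa aX] /inflt[c Ac cY]].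
  have [d Ad dac] := Adir a c Aa Ac.
  have [[da _] [_ dc]] := (dac X, dac Y).
  have := infle _ (oplus X Y) Ad; rewrite (Amax _ _ _ Ad) leNgt gt_max.
  by rewrite (le_lt_trans da aX) (le_lt_trans dc cY).
- apply: leinf => a Aa; apply: le_trans (Amuln a n X Aa).
  by rewrite lerMn2r infle ?orbT.
Qed.

Definition max_sublinear_drop q X Y : R :=
  inf [set a Y | a in range (fun n Z => q (Z + X *+ n) - q X *+ n)].

(** The terms decrease in n and are bounded below, so they form a directed family. The last clause,
    the term n = 1 at [- X], is what later forces additivity. *)
Lemma max_sublinear_dropP q X : max_sublinear q ->
  [/\ max_sublinear (max_sublinear_drop q X),
      forall Y, max_sublinear_drop q X Y <= q Y &
      max_sublinear_drop q X (- X) <= - q X].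
Proof.
move=> mq; pose a n Z := q (Z + X *+ n) - q X *+ n.
(* n q X <= q (nX) <= q (Z + nX) + q (-Z). *)
have a_lb n Z : - q (- Z) <= a n Z.
  rewrite lerBrDr addrC lerBlDr; apply: le_trans (max_sublinearMn mq _ _) _.
  have := max_sublinearD mq (Z + X *+ n) (- Z).
  by rewrite addrAC subrr add0r.
have a_decr n k Z : a (n + k)%N Z <= a n Z.
  elim: k => [|k IH]; first by rewrite addn0.
  apply: le_trans IH; rewrite /a addnS !mulrSr addrA opprD addrA.
  by rewrite lerBlDr [leRHS]addrAC lerD2r; exact: max_sublinearD.
have drop_le n Z : max_sublinear_drop q X Z <= a n Z.
  apply: ge_inf; last by exists (a n) => //; exists n.
  by exists (- q (- Z)) => _ [_ [m _ <-] <-]; exact: a_lb.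
split.
- apply: (max_sublinear_inf (b := fun Z => - q (- Z))).
  + by exists (a 0%N), 0%N.
  + by move=> _ Z [n _ <-]; exact: a_lb.
  + move=> _ Y Z [n _ <-]; rewrite addr_oplusl (max_sublinear_oplus mq).
    by rewrite addr_maxl.
  + move=> _ n Z [m _ <-].
    case: n => [|n]; first by rewrite /= !mulr0n add0r subr_ge0; exact: max_sublinearMn.
    (* Scaling Z by n+1 scales the shift mX too, which leads to index m(n+1); its value is at most
       that at index m. *)
    apply: (@le_trans _ _ (a (m * n.+1)%N (Z *+ n.+1))).
      rewrite mulrnBl -mulrnA lerD2r.
      by apply: le_trans (max_sublinearMn mq _ _) _; rewrite mulrnDl mulrnA.
    by rewrite mulnS; exact: a_decr.
  + move=> _ _ [n _ <-] [m _ <-]; exists (a (n + m)%N); first by exists (n + m)%N.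
    by move=> Z; split; [|rewrite addnC]; exact: a_decr.
  + move=> _ _ Y Z [n _ <-] [m _ <-]; exists (a (n + m)%N); first by exists (n + m)%N.
    rewrite /a !mulrnDr opprD addrACA [leRHS]addrACA lerD2r.
    exact: max_sublinearD.
- by move=> Y; apply: le_trans (drop_le 0%N Y) _; rewrite /a !mulr0n addr0 subr0.
- by apply: le_trans (drop_le 1%N _) _; rewrite /a !mulr1n addNr (max_sublinear_0 mq) sub0r.
Qed.

(** Zorn's lemma for the reversed pointwise order on the functionals below p. Their common lower
    bound [- p (- X)] keeps infima over chains real. *)
Lemma max_sublinear_minimal p : max_sublinear p ->
  exists q, [/\ max_sublinear q, forall X, q X <= p X &
    forall q', max_sublinear q' -> (forall X, q' X <= q X) -> q' = q].
Proof.
move=> mp.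
pose T := {q : F -> R | max_sublinear q /\ forall X, q X <= p X}.
pose le' (q1 q2 : T) := `[< forall X, sval q2 X <= sval q1 X >].
have T_lb (q : T) X : - p (- X) <= sval q X.
  case: q => q [mq qp] /=; apply: le_trans (max_sublinear_opp X mq).
  by rewrite lerN2.
have [||||q qmin] := @Zorn T le'.
- by move=> q; apply/asboolP.
- move=> q1 q2 q3 /asboolP le12 /asboolP le23; apply/asboolP => X.
  exact: le_trans (le23 X) (le12 X).
- move=> [q1 h1] [q2 h2] /asboolP /= le12 /asboolP /= le21; apply: eq_exist.
  by apply/funext => X; apply/eqP; rewrite eq_le le12 le21.
- move=> A Atot.
  have [A0|A0] := pselect (A !=set0); last first.
    by exists (exist _ p (conj mp (fun X => lexx (p X)))) => q Aq; case: A0; exists q.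
  pose A' := [set sval q | q in A].
  have A'dir a c : A' a -> A' c -> exists2 d, A' d & forall X, d X <= a X /\ d X <= c X.
    move=> [q1 Aq1 <-] [q2 Aq2 <-].
    have [/asboolP le12|/asboolP le21] := Atot _ _ Aq1 Aq2.
      by exists (sval q2) => [|X]; [exists q2|split].
    by exists (sval q1) => [|X]; [exists q1|split].
  have mg : max_sublinear (fun X => inf [set a X | a in A']).
    apply: (max_sublinear_inf (b := fun X => - p (- X))).
    + by case: A0 => q Aq; exists (sval q), q.
    + by move=> _ X [q Aq <-].
    + by move=> _ X Y [q _ <-]; have [mq _] := svalP q; exact: max_sublinear_oplus.
    + by move=> _ n X [q _ <-]; have [mq _] := svalP q; exact: max_sublinearMn.
    + exact: A'dir.
    + move=> a c X Y Aa Ac; have [d Ad dac] := A'dir a c Aa Ac; exists d => //.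
      have [q Aq qd] := Ad; have [mq _] := svalP q; rewrite qd in mq.
      apply: le_trans (max_sublinearD mq X Y) _.
      by have [[? _] [_ ?]] := (dac X, dac Y); rewrite lerD.
  have gle (q : T) X : A q -> inf [set a X | a in A'] <= sval q X.
    move=> Aq; apply: ge_inf; last by exists (sval q) => //; exists q.
    by exists (- p (- X)) => _ [_ [q' _ <-] <-].
  have gp X : inf [set a X | a in A'] <= p X.
    case: A0 => q Aq; apply: le_trans (gle q X Aq) _.
    by case: (q) => ? [].
  exists (exist _ (fun X => inf [set a X | a in A']) (conj mg gp) : T) => q Aq; apply/asboolP => X /=.
  exact: gle.
- exists (sval q); have [mq qp] := svalP q; split => // q' mq' q'q.
  have q'p X : q' X <= p X := le_trans (q'q X) (qp X).
  by rewrite -(qmin (exist _ q' (conj mq' q'p) : T)) //; apply/asboolP.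
Qed.

(** Minimality identifies q with its drop along Z, whence q (-Z) <= - q Z. Writing X as (X + Y) - Y
    then gives the missing inequality. *)
Lemma max_sublinear_minimal_additive q : max_sublinear q ->
    (forall q', max_sublinear q' -> (forall X, q' X <= q X) -> q' = q) ->
  {morph q : X Y / X + Y}.
Proof.
move=> mq qmin X Y.
have qN Z : q (- Z) <= - q Z.
  have [md dle dN] := max_sublinear_dropP Z mq.
  by rewrite (qmin _ md dle) in dN.
apply/eqP; rewrite eq_le (max_sublinearD mq) /= -lerBrDr.
rewrite -{1}[X](addrK Y); apply: le_trans (max_sublinearD mq _ _) _.
by rewrite lerD2l; exact: qN.
Qed.

End MaxSublinear.

(** * Characters as monotone group morphisms normalised at E *)

Section Character.
Context {R : realType} {F : perfectSemifieldType} {E : F}.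
Implicit Types (X Y : F) (phi : charspace R E).

Lemma charevalD phi : {morph (fun X => chareval X phi) : X Y / X + Y}.
Proof. by case: (set_valP phi) => -[]. Qed.

Lemma chareval_oplus phi :
  {morph (fun X => chareval X phi) : X Y / oplus X Y >-> Num.max X Y}.
Proof. by case: (set_valP phi) => -[]. Qed.

Lemma chareval_unit phi : chareval E phi = 1.
Proof. by case: (set_valP phi). Qed.

Lemma chareval0 phi : chareval 0 phi = 0.
Proof. by apply: (addrI (chareval 0 phi)); rewrite -charevalD !addr0. Qed.

Lemma charevalN phi X : chareval (- X) phi = - chareval X phi.
Proof. by apply/eqP; rewrite -addr_eq0 -charevalD addNr chareval0. Qed.

Lemma charevalB phi X Y : chareval (X - Y) phi = chareval X phi - chareval Y phi.
Proof. by rewrite charevalD charevalN. Qed.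

Lemma charevalMn phi n X : chareval (X *+ n) phi = chareval X phi *+ n.
Proof. by elim: n => [|n IH]; rewrite ?chareval0// !mulrS charevalD IH. Qed.

Lemma charevalMz phi (m : int) X : chareval (X *~ m) phi = chareval X phi *~ m.
Proof.
by case: m => n; rewrite ?NegzE ?mulrNz ?charevalN -!pmulrn charevalMn.
Qed.

Lemma chareval_le phi X Y : sfle X Y -> chareval X phi <= chareval Y phi.
Proof. by move=> <-; rewrite chareval_oplus le_max lexx. Qed.

Lemma chareval_ratscale phi (t : rat) : chareval (ratscale t E) phi = ratr t.
Proof.
have q0 : `|denq t|%:R != 0 :> R by rewrite pnatr_eq0 absz_eq0 denq_eq0.
apply: (mulIf q0); rewrite mulr_natr -charevalMn ratscaleP charevalMz chareval_unit.
by rewrite pmulrn absz_denq -!(ratr_int R) -rmorphM -numqE.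
Qed.

End Character.

(** * The gauge, and characters attaining it *)

Section Gauge.
Context {R : realType} {F : perfectSemifieldType} {E : F}.
Hypothesis stdE : standing_assumptions R E.
Implicit Types (X Y : F) (s t : rat).

Lemma unit_bound0 X : unit_bound E X 0 -> X = 0.
Proof. by case=> _; rewrite ratscale0 oppr0 => X0 X0'; exact: sfle_anti. Qed.

(** A nonzero X has a bound t > 0, and -tE <= X <= tE gives 0 <= 2tE. *)
Lemma unit_ge0 : sfle 0 E.
Proof.
have [X X0] := semifield_nontrivial stdE.
have [t tX] := unit_bound_nonempty stdE X.
have [t0 lX uX] := tX.
have {}t0 : 0 < t.
  rewrite lt_neqAle t0 andbT; apply: contra_neq X0 => t0'.
  by apply: unit_bound0; rewrite t0'.
apply/(ratscale_pge0 _ t0)/(@sfle_pmulrn _ 2) => //; rewrite mul0rn mulr2n.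
by have /(sfleD2l (ratscale t E)) := sfle_trans lX uX; rewrite subrr.
Qed.

Lemma unit_neq0 : E <> 0.
Proof.
move=> E0; have [X /eqP] := semifield_nontrivial stdE; apply.
have [t [t0 lX uX]] := unit_bound_nonempty stdE X.
by apply: sfle_anti; [move: uX | move: lX]; rewrite E0 ratscaler0 ?oppr0.
Qed.

Lemma sfle_ratscale s t : sfle (ratscale s E) (ratscale t E) <-> s <= t.
Proof.
have mono u v : u <= v -> sfle (ratscale u E) (ratscale v E).
  rewrite le_eqVlt => /predU1P[->|uv]; first exact: sfle_refl.
  apply/sfle_subr_ge0; rewrite -ratscaleN -ratscaleD.
  by apply/ratscale_pge0; [rewrite subr_gt0|exact: unit_ge0].
split=> [st|]; last exact: mono.
(* If t < s, antisymmetry gives sE = tE, so (s - t)E = 0; hence E <= 0 and E = 0. *)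
rewrite leNgt; apply/negP => ts; apply: unit_neq0.
have eq_st : ratscale s E = ratscale t E by apply: sfle_anti => //; exact/mono/ltW.
apply: sfle_anti; last exact: unit_ge0.
rewrite -oppr0 -[E]opprK; apply: sfleN; apply/(@ratscale_pge0 _ (s - t)).
  by rewrite subr_gt0.
rewrite ratscalerN ratscaleD ratscaleN eq_st subrr oppr0; exact: sfle_refl.
Qed.

(** A one-sided, signed form of the radius: t may be negative. *)
Definition gauge X : R := inf [set ratr t | t in [set t | sfle X (ratscale t E)]].

Lemma gauge_le X t : sfle X (ratscale t E) -> gauge X <= ratr t.
Proof.
move=> Xt; apply: ge_inf; last by exists t.
have [u [_ lX _]] := unit_bound_nonempty stdE X.
exists (ratr (- u)) => _ [s /= Xs <-]; rewrite ler_rat; apply/sfle_ratscale.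
by rewrite ratscaleN; exact: sfle_trans lX Xs.
Qed.

Lemma gauge_ge X (r : R) :
  (forall t, sfle X (ratscale t E) -> r <= ratr t) -> r <= gauge X.
Proof.
move=> rX; apply: lb_le_inf; last by move=> _ [t /= Xt <-]; exact: rX.
have [u [_ _ uX]] := unit_bound_nonempty stdE X; by exists (ratr u), u.
Qed.

Lemma gauge_lt X t : gauge X < ratr t -> sfle X (ratscale t E).
Proof.
move=> /inf_lt[|_ [s /= Xs <-]].
  have [u [_ _ uX]] := unit_bound_nonempty stdE X; by exists (ratr u), u.
rewrite ltr_rat => st; apply: sfle_trans Xs _; exact/sfle_ratscale/ltW.
Qed.

Lemma max_sublinear_gauge : max_sublinear gauge.
Proof.
have gauge_ltr X (r : R) : gauge X < r -> exists2 t, ratr t < r & sfle X (ratscale t E).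
  move=> /rat_in_itvoo[t]; rewrite in_itv /= => /andP[Xt tr].
  by exists t => //; exact: gauge_lt.
split=> [X Y|X Y|n X].
- apply/ler_addgt0Pr => e e0.
  have [|s se Xs] := gauge_ltr X (gauge X + e / 2); first by rewrite ltrDl divr_gt0.
  have [|t te Yt] := gauge_ltr Y (gauge Y + e / 2); first by rewrite ltrDl divr_gt0.
  apply: (@le_trans _ _ (ratr (s + t))).
    by apply: gauge_le; rewrite ratscaleD; exact: sfleD.
  by rewrite rmorphD /= [e]splitr addrACA lerD// ltW.
- apply/eqP; rewrite eq_le; apply/andP; split; last first.
    by rewrite ge_max; apply/andP; split; apply: gauge_ge => t Xt; apply: gauge_le;
      apply: sfle_trans Xt; [exact: sfle_oplusl|exact: sfle_oplusr].
  rewrite leNgt; apply/negP => /rat_in_itvoo[t]; rewrite in_itv /= gt_max.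
  move=> /andP[/andP[/gauge_lt Xt /gauge_lt Yt]].
  by rewrite ltNge gauge_le //; exact: oplus_sfle.
- apply: gauge_ge => t Xt; case: n Xt => [|n] Xt.
    by rewrite mulr0n ler0q; apply/sfle_ratscale; rewrite ratscale0.
  (* The bound t on (n+1)X becomes the bound t/(n+1) on X by torsion-freeness of the order. *)
  have n0 : n.+1%:R != 0 :> rat by rewrite pnatr_eq0.
  have tE : t = (t / n.+1%:R) *+ n.+1 by rewrite -mulr_natr divfK.
  rewrite tE rmorphMn /= lerMn2r /=; apply: gauge_le.
  by apply: (@sfle_pmulrn _ n.+1) => //; rewrite -ratscaleMn -tE.
Qed.

Lemma exists_charspace_gauge X : exists phi : charspace R E, chareval X phi = gauge X.
Proof.
have [mq0 q0_le q0X] := max_sublinear_dropP X max_sublinear_gauge.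
have [q [mq qq0 qmin]] := max_sublinear_minimal mq0.
have qD := max_sublinear_minimal_additive mq qmin.
have qN Y : q (- Y) = - q Y.
  by apply/eqP; rewrite -addr_eq0 -qD addNr max_sublinear_0.
have q_le Y : q Y <= gauge Y := le_trans (qq0 Y) (q0_le Y).
have ratr1 : ratr 1 = 1 :> R by rewrite rmorph1.
(* The gauges of E and -E are at most 1 and -1, which bounds q E from both sides. *)
have qE : q E = 1.
  apply/eqP; rewrite eq_le; apply/andP; split.
    apply: le_trans (q_le E) _.
    by rewrite -ratr1; apply: gauge_le; rewrite ratscale1; exact: sfle_refl.
  rewrite -lerN2 -qN; apply: le_trans (q_le _) _.
  have -> : (-1 : R) = ratr (- 1) by rewrite rmorphN /= ratr1.
  by apply: gauge_le; rewrite ratscaleN ratscale1; exact: sfle_refl.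
have qchar : is_character q.
  by split; [exists E; rewrite qE oner_neq0|exact: max_sublinear_oplus mq|].
exists (exist _ q (mem_set (conj qchar qE))); rewrite /chareval /=.
(* Lying below the drop along X, q satisfies q (-X) <= - gauge X; with q <= gauge this determines q
   X. *)
by apply/eqP; rewrite eq_le q_le /= -lerN2 -qN (le_trans (qq0 _)).
Qed.

Lemma chareval_le_radius X (phi : charspace R E) :
  `|chareval X phi| <= unit_radius R E X.
Proof.
apply: lb_le_inf; first by have [u uX] := unit_bound_nonempty stdE X; exists (ratr u), u.
move=> _ [t [t0 /(chareval_le phi) lX /(chareval_le phi) uX] <-].
by move: lX uX; rewrite charevalN chareval_ratscale ler_norml => -> ->.
Qed.

(** A rational t strictly between r and the radius would exceed the gauges of X and -X, which are
    values of characters. Then t would lie in [unit_bound E X], against t being less than the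
    radius. *)
Lemma unit_radius_le X (r : R) :
  (forall phi : charspace R E, `|chareval X phi| <= r) -> unit_radius R E X <= r.
Proof.
move=> Xr; rewrite leNgt; apply/negP => /rat_in_itvoo[t]; rewrite in_itv /=.
move=> /andP[rt]; apply/negP; rewrite -leNgt.
have gauge_t Y : (exists phi : charspace R E, gauge Y <= `|chareval X phi|) ->
    sfle Y (ratscale t E).
  by move=> [phi Yphi]; apply: gauge_lt; apply: le_lt_trans rt; apply: le_trans (Xr phi).
have Xt : sfle X (ratscale t E).
  apply: gauge_t; have [phi <-] := exists_charspace_gauge X; exists phi.
  exact: ler_norm.
have NXt : sfle (- X) (ratscale t E).
  apply: gauge_t; have [phi <-] := exists_charspace_gauge (- X); exists phi.
  by rewrite charevalN -normrN ler_norm.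
have {}NXt : sfle (- ratscale t E) X by rewrite -[X]opprK; exact: sfleN.
apply: ge_inf; first by exists 0 => _ [s [s0 _ _] <-]; rewrite ler0q.
exists t => //; split=> //.
(* Nonnegativity of t is read off from -tE <= tE. *)
have := sfle_trans NXt Xt; rewrite -ratscaleN => /sfle_ratscale.
by rewrite -subr_ge0 opprK -mulr2n pmulrn_lge0.
Qed.

End Gauge.

(** * Filter tools and compactness of the character space *)

Lemma ultra_cvg_compact (T : Type) (U : topologicalType) (G : set_system T)
    (f : T -> U) (K : set U) :
  UltraFilter G -> compact K -> G (f @^-1` K) -> exists l : U, f x @[x --> G] --> l.
Proof.
move=> GU cK GK; have GP : ProperFilter G by exact: ultra_proper.
have [l [_ lG]] := cK (fmap f G) (fmap_proper_filter f GP) GK.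
exists l => B lB; have [//|GB] := in_ultra_setVsetC (f @^-1` B) GU.
by have [x [xNB xB]] := lG (~` B) B GB lB.
Qed.

(** Plays the role of finite subcovers: if the ideal Q missed the whole space, the complements of
    its members would form a proper filter, and its cluster point would have a neighbourhood in
    Q. *)
Lemma compact_ideal_setT (T : topologicalType) (Q : set (set T)) :
    compact [set: T] -> Q set0 ->
    (forall A B, A `<=` B -> Q B -> Q A) ->
    (forall A B, Q A -> Q B -> Q (A `|` B)) ->
    (forall x : T, exists2 A, nbhs x A & Q A) ->
  Q [set: T].
Proof.
move=> cT Q0 Qsub QU Qloc; apply: contrapT => NQT.
pose G : set_system T := [set A | Q (~` A)].
have GF : Filter G.
  split=> [|A B GA GB|A B AB]; rewrite /G /=; first by rewrite setCT.
    by rewrite setCI; exact: QU.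
  by apply: Qsub; exact: subsetC.
have GP : ProperFilter G by apply: Build_ProperFilter; rewrite /G /= setC0.
have [x [_ xG]] := cT G GP filterT.
have [A xA QA] := Qloc x.
by have [|y [yNA yA]] := xG (~` A) A _ xA; [rewrite /G /= setCK|].
Qed.

Section CompactCharspace.
Context {R : realType} {F : perfectSemifieldType} {E : F}.
Hypothesis stdE : standing_assumptions R E.

Lemma charspace_cvg (G : set_system (charspace R E)) (phi : charspace R E) :
  Filter G -> (forall X, chareval X psi @[psi --> G] --> chareval X phi) -> G --> phi.
Proof.
move=> FG Gphi; apply/cvg_sup => X A [_ [[B oB <-] Bphi] BA].
by apply: filterS BA _; apply: Gphi; exact: open_nbhs_nbhs.
Qed.

(** Tychonoff's argument: evaluation at X stays in a segment given by the radius, so it converges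
    along any ultrafilter. The identities defining normalised characters pass to the pointwise
    limit. *)
Lemma compact_charspace : compact [set: charspace R E].
Proof.
rewrite compact_ultra => G GU _; have GP : ProperFilter G by exact: ultra_proper.
have lim X : exists l, chareval X psi @[psi --> G] --> (l : R).
  pose r := unit_radius R E X.
  apply: (ultra_cvg_compact GU (segment_compact (a := - r) (b := r))).
  apply: filterE => psi /=; rewrite in_itv /= -ler_norml.
  exact: chareval_le_radius.
have [l lP] := choice lim.
have uniq (f : charspace R E -> R) (a b : R) :
    f psi @[psi --> G] --> a -> f psi @[psi --> G] --> b -> a = b.
  by move=> fa fb; apply: (cvg_unique _ fa fb); exact: norm_hausdorff.
have lE : l E = 1.
  apply: uniq (lP E) _.
  by under eq_fun do rewrite chareval_unit; exact: cvg_cst.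
have lchar : is_character l.
  split; first by exists E; rewrite lE oner_neq0.
  - move=> X Y; apply: uniq (lP _) _.
    under eq_fun do rewrite chareval_oplus.
    apply: continuous2_cvg; [|exact: lP|exact: lP].
    apply: (@continuous_max R (R * R)%type fst snd (l X, l Y)).
      exact: cvg_fst.
    exact: cvg_snd.
  - move=> X Y; apply: uniq (lP _) _.
    under eq_fun do rewrite charevalD.
    exact: cvgD.
exists (exist _ l (mem_set (conj lchar lE))); split=> //.
exact: charspace_cvg.
Qed.

End CompactCharspace.

(** * Density by the lattice Stone-Weierstrass argument *)

Lemma near_continuous_ltrD (R : realType) (T : topologicalType) (f g : T -> R)
    (c : R) (x : T) : continuous f -> continuous g ->
  f x < g x + c -> \forall y \near x, f y < g y + c.
Proof.
move=> fc gc fgx; have fgc : {for x, continuous (fun y => f y - g y)}.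
  by apply: cvgB; [exact: fc|exact: gc].
near=> y; rewrite -ltrBlDl; near: y.
by apply: (fgc [set r | r < c]); apply: lt_nbhsl; rewrite ltrBlDl.
Unshelve. all: by end_near. Qed.

Section Density.
Context {R : realType} {F : perfectSemifieldType} {E : F}.
Hypothesis stdE : standing_assumptions R E.
Implicit Types (X Y : F) (phi psi : charspace R E) (f : charspace R E -> R).

(** The inequalities are one-sided, so it suffices that some Y grows by at least b - a from phi to
    psi; a rational multiple of E adjusts the level. Distinct characters differ somewhere, and a
    large multiple widens the gap. *)
Lemma charspace_interpolation phi psi (a b e : R) : 0 < e ->
  (phi = psi -> a = b) ->
  exists X, chareval X phi < a + e /\ b - e < chareval X psi.
Proof.
move=> e0 ab.
suff [Y abY] : exists Y, b - a <= chareval Y psi - chareval Y phi.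
  have /rat_in_itvoo[t] : b - e - chareval Y psi < a + e - chareval Y phi.
    have : b - a - (e + e) < chareval Y psi - chareval Y phi.
      by apply: lt_le_trans abY; rewrite gtrBl addr_gt0.
    lra.
  rewrite in_itv /= => /andP[bt ta]; exists (Y + ratscale t E).
  by rewrite !charevalD !chareval_ratscale; split; lra.
have [phipsi|phipsi] := pselect (phi = psi).
  by exists 0; rewrite !chareval0 (ab phipsi) !subrr.
have [Y Ylt] : exists Y, 0 < chareval Y psi - chareval Y phi.
  have [Y /eqP] : exists Y, chareval Y phi <> chareval Y psi.
    by apply/existsNP => eq_pp; apply: phipsi; apply/val_inj/funext.
  rewrite neq_lt => /orP[lt|gt]; first by exists Y; rewrite subr_gt0.
  by exists (- Y); rewrite !charevalN opprK addrC subr_gt0.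
exists (Y *+ Num.bound `|(b - a) / (chareval Y psi - chareval Y phi)|).
rewrite !charevalMn -mulrnBl -mulr_natl -ler_pdivrMr// ltW//.
exact: le_lt_trans (ler_norm _) (archi_boundP (normr_ge0 _)).
Qed.

Lemma chareval_dense f (e : R) : continuous f -> 0 < e ->
  exists X, forall phi, `|chareval X phi - f phi| < e.
Proof.
move=> fc e0; have cS := compact_charspace stdE.
(* For fixed phi, joins of interpolants between phi and various psi stay below f + e at phi and
   exceed f - e on ever larger sets. *)
have upper phi : exists X, chareval X phi < f phi + e /\
    forall psi, f psi - e < chareval X psi.
  pose Q := [set A | exists X, chareval X phi < f phi + e /\
    forall psi, A psi -> f psi - e < chareval X psi].
  suff [X [Xlt Xgt]] : Q setT by exists X; split=> // psi; exact: Xgt.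
  apply: compact_ideal_setT => //.
  - by have [|//|X [Xlt _]] := @charspace_interpolation phi phi (f phi) (f phi) e; last exists X.
  - by move=> A B AB [X [Xlt XB]]; exists X; split=> // psi /AB; exact: XB.
  - move=> A B [X [Xlt XA]] [Y [Ylt YB]]; exists (oplus X Y).
    split; first by rewrite chareval_oplus gt_max Xlt.
    move=> psi [/XA|/YB]; rewrite chareval_oplus lt_max => -> //.
    by rewrite orbT.
  - move=> psi; have [||X [Xlt Xgt]] := @charspace_interpolation phi psi (f phi) (f psi) e => //.
      by move=> ->.
    exists [set chi | f chi < chareval X chi + e].
      by apply: near_continuous_ltrD; rewrite -?ltrBlDr//; exact: chareval_continuous.
    by exists X; split=> // chi /=; rewrite ltrBlDr.
(* Dually, meets of the elements from [upper] still exceed f - e everywhere and go below f + e on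
   ever larger sets. *)
pose Q := [set A | exists X, (forall psi, f psi - e < chareval X psi) /\
  forall psi, A psi -> chareval X psi < f psi + e].
suff [X [Xgt Xlt]] : Q setT.
  by exists X => phi; rewrite ltr_distl Xgt Xlt.
(* Some character is needed for [upper] to settle the empty set. *)
have [phi0 _] := exists_charspace_gauge stdE 0.
apply: compact_ideal_setT => //.
- by have [X [_ Xgt]] := upper phi0; exists X.
- by move=> A B AB [X [Xgt XB]]; exists X; split=> // psi /AB; exact: XB.
- move=> A B [X [Xgt XA]] [Y [Ygt YB]]; exists (- oplus (- X) (- Y)).
  have meetE psi : chareval (- oplus (- X) (- Y)) psi =
      Num.min (chareval X psi) (chareval Y psi).
    by rewrite charevalN chareval_oplus !charevalN oppr_max !opprK.
  split=> [psi|psi]; first by rewrite meetE lt_min Xgt Ygt.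
  by rewrite meetE gt_min => -[/XA->|/YB->]; rewrite ?orbT.
- move=> phi; have [X [Xlt Xgt]] := upper phi.
  exists [set chi | chareval X chi < f chi + e]; last by exists X.
  by apply: near_continuous_ltrD => //; exact: chareval_continuous.
Qed.

End Density.

(** * Bijectivity of [Theta] *)

Section Representation.
Context {R : realType} {F : perfectSemifieldType} {E : F}.
Hypothesis banachE : banach_semifield R E.

Lemma Theta_inj : injective (Theta R E).
Proof.
have [stdE _] := banachE.
move=> X Y XY; apply/eqP; rewrite -subr_eq0; apply/eqP.
apply/(unit_radius_eq0 stdE); apply/eqP; rewrite eq_le; apply/andP; split.
  apply: (unit_radius_le stdE) => phi; rewrite charevalB.
  have -> : chareval X phi = chareval Y phi.
    exact: (congr1 (fun f : continuousType (charspace R E) R => f phi) XY).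
  by rewrite subrr normr0.
have [phi _] := exists_charspace_gauge stdE 0.
exact: le_trans (normr_ge0 _) (chareval_le_radius stdE (X - Y) phi).
Qed.

(** Approximants of f within 1/(n+1) are Cauchy because characters control the radius, and
    evaluating at each phi shows that their limit maps to f. *)
Lemma Theta_surj (f : continuousType (charspace R E) R) :
  exists X, Theta R E X = f.
Proof.
have [stdE complE] := banachE.
have fc : continuous f by move=> phi; exact: cts_fun.
have dense n : exists X, forall phi, `|chareval X phi - f phi| < n.+1%:R^-1.
  by apply: chareval_dense => //; rewrite invr_gt0 ltr0n.
have [u uP] := choice dense.
have uf_cvg phi : chareval (u n) phi @[n --> \oo] --> f phi.
  apply/cvgrPdist_lt => e e0.
  near=> n; rewrite distrC; apply: lt_trans (uP n phi) _.
  near: n; exact: near_infty_natSinv_lt (PosNum e0).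
have [e e0|l ul] := complE u.
  (* [unit_radius_le] gives only a weak bound, here 2e/3, which is still strictly below e. *)
  have e30 : 0 < e / 3 by rewrite divr_gt0.
  have [N _ HN] := near_infty_natSinv_lt (PosNum e30).
  exists N => m n Nm Nn; apply: (@le_lt_trans _ _ (e / 3 + e / 3)); last by lra.
  apply: (unit_radius_le stdE) => phi; rewrite charevalB.
  apply: le_trans (ler_distD (f phi) _ _) _; rewrite [X in _ + X]distrC.
  by rewrite lerD// (ltW (lt_trans (uP _ _) (HN _ _))).
exists l; apply/continuousEP => phi.
apply: (cvg_unique _ _ (uf_cvg phi)); first exact: norm_hausdorff.
apply/cvgrPdist_lt => e e0.
near=> n; rewrite distrC -charevalB.
apply: (le_lt_trans (chareval_le_radius stdE _ _)).
apply: (le_lt_trans (ler_norm _)); near: n.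
by move/cvgr0Pnorm_lt : ul; exact.
Unshelve. all: by end_near. Qed.
End Representation.

(** * Transport of the Banach structure along an isomorphism *)

Section Isomorphism.
Context {R : realType} {F G : perfectSemifieldType} {h : F -> G}.
Hypothesis h_bij : bijective h.
Hypothesis h_oplus : {morph h : X Y / oplus X Y >-> oplus X Y}.
Hypothesis hD : {morph h : X Y / X + Y}.

Let h_inj : injective h := bij_inj h_bij.

Let h0 : h 0 = 0.
Proof. by apply: (addrI (h 0)); rewrite -hD !addr0. Qed.

Let hN X : h (- X) = - h X.
Proof. by apply/eqP; rewrite -addr_eq0 -hD addNr h0. Qed.

Let hMn n X : h (X *+ n) = h X *+ n.
Proof. by elim: n => [|n IH]; rewrite ?h0// !mulrS hD IH. Qed.

Lemma iso_sfle X Y : sfle (h X) (h Y) <-> sfle X Y.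
Proof. by rewrite /sfle -h_oplus; split=> [/h_inj|->]. Qed.

Lemma iso_ratscale (t : rat) X : h (ratscale t X) = ratscale t (h X).
Proof.
apply: (@ratscale_unique _ _ (numq t) `|denq t|).
- by rewrite absz_gt0 denq_eq0.
- exact: mulr_absz_denq.
- rewrite -hMn ratscaleP; case: (numq t) => n; last rewrite NegzE !mulrNz hN.
    by rewrite -!pmulrn hMn.
  by rewrite -!pmulrn hMn.
Qed.

Lemma iso_unit_bound E X : unit_bound (h E) (h X) = unit_bound E X.
Proof.
apply/funext => t; apply/propext; rewrite /unit_bound /= -iso_ratscale -hN.
by split=> -[t0 /iso_sfle lX /iso_sfle uX].
Qed.

Lemma iso_unit_radius E X : unit_radius R (h E) (h X) = unit_radius R E X.
Proof. by rewrite /unit_radius iso_unit_bound. Qed.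

(** Order, rational multiples and radius depend only on [oplus] and +, so h preserves them; Cauchy
    sequences are pulled back by g. Applied to [Theta], this makes the function space Banach. *)
Lemma iso_banach_semifield E : banach_semifield R E -> banach_semifield R (h E).
Proof.
have [g hK gK] := h_bij.
have gB X Y : h (g X - g Y) = X - Y by rewrite hD hN !gK.
move=> [[[X X0] bne r0] compl]; split; first split.
- by exists (h X); rewrite -h0 (inj_eq h_inj).
- by move=> Y; rewrite -[Y]gK iso_unit_bound; exact: bne.
- move=> Y; rewrite -[Y]gK iso_unit_radius r0 -h0.
  by split=> [->|/h_inj].
- move=> u ucauchy; have [|l ul] := compl (g \o u).
    move=> e /ucauchy[N HN]; exists N => m n Nm Nn /=.
    by rewrite -iso_unit_radius gB HN.
  exists (h l); suff -> : (fun n => unit_radius R (h E) (u n - h l)) =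
      (fun n => unit_radius R E ((g \o u) n - l)) by exact: ul.
  by apply/funext => n; rewrite -iso_unit_radius hD hN gK.
Qed.

End Isomorphism.

Theorem theorem5 (R : realType) (F : perfectSemifieldType) (E : F)
    (banachF : banach_semifield R E) :
  [/\ banach_semifield R (cst 1 : continuousType (charspace R E) R),
      [/\ bijective (Theta R E),
          {morph Theta R E : X Y / oplus X Y >-> oplus X Y},
          {morph Theta R E : X Y / X + Y >-> X + Y} &
          forall X Y : F,
            unit_radius R (cst 1 : continuousType (charspace R E) R)
              (Theta R E X - Theta R E Y) = unit_radius R E (X - Y)],
      forall X : F, (unit_radius R E X)%:E =
        ereal_sup [set `|Theta R E X phi|%:E | phi in [set: charspace R E]] &
      forall phi : charspace R E, Theta R E E phi = 1].
Proof.
have [stdE _] := banachF.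
have Theta_oplus : {morph Theta R E : X Y / oplus X Y >-> oplus X Y}.
  by move=> X Y; apply/continuousEP => phi; exact: chareval_oplus.
have ThetaD : {morph Theta R E : X Y / X + Y}.
  by move=> X Y; apply/continuousEP => phi; exact: charevalD.
have ThetaE : Theta R E E = (cst 1 : continuousType (charspace R E) R).
  by apply/continuousEP => phi; exact: chareval_unit.
have Theta_bij : bijective (Theta R E).
  have [g gK] := choice (Theta_surj banachF).
  by exists g => // X; apply: (Theta_inj banachF); rewrite gK.
split.
- by rewrite -ThetaE; exact: iso_banach_semifield.
- split=> // X Y; rewrite -ThetaE -(iso_unit_radius Theta_bij Theta_oplus ThetaD).
  by congr unit_radius; apply/continuousEP => phi; rewrite [RHS]charevalB.
- move=> X; apply/eqP; rewrite eq_le; apply/andP; split; last first.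
    apply: ge_ereal_sup => _ [phi _ <-]; rewrite lee_fin.
    exact: chareval_le_radius.
  set s := ereal_sup _.
  have phi_le (phi : charspace R E) : (`|chareval X phi|%:E <= s)%E.
    by apply: ereal_sup_ubound; exists phi.
  (* The value +oo bounds the radius trivially, and -oo is excluded by the existence of a
     character. *)
  case: s phi_le => [r| |] phi_le; last 2 first.
  + by rewrite leey.
  + by have [phi _] := exists_charspace_gauge stdE 0; have := phi_le phi.
  by rewrite lee_fin; apply: (unit_radius_le stdE) => phi; rewrite -lee_fin.
- exact: chareval_unit.
Qed.
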